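(* Let $k\ge 3$ and let $n$ be a positive integer with $n\equiv 0\pmod{\frac{4^k-1}{3}}$. Then there is no quaternary Hermitian LCD $[n,k,\alpha_4(n,k)]$ code. (Equivalently, writing $n=\frac{4^k-1}{3}s$, there is no quaternary Hermitian LCD $[\frac{4^k-1}{3}s,k,4^{k-1}s]$ code.)
   Context: $\mathbb{F}_4=\{0,1,\omega,\omega^2\}$ with $\omega^2=\omega+1$, $\overline{x}=x^2$. A quaternary $[n,k,d]$ code is a $k$-dimensional subspace of $\mathbb{F}_4^n$ with minimum nonzero Hamming weight $d$. Its Hermitian dual is $C^{\perp_H}=\{x : \sum_i x_i\overline{y_i}=0\ \forall y\in C\}$, and $C$ is Hermitian LCD if $C\cap C^{\perp_H}=\{0\}$. $\alpha_4(n,k)=\max\{d\in\mathbb{Z}_{\ge0} : n\ge\sum_{i=0}^{k-1}\lceil d/4^i\rceil\}$ (the Griesmer bound value). *)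

(* Defs.v *)
From mathcomp Require Import all_boot all_order all_algebra all_field.
Set Implicit Arguments. Unset Strict Implicit. Unset Printing Implicit Defensive.
Import GRing.Theory.
Local Open Scope ring_scope.

Definition wt (F : finFieldType) (n : nat) (x : 'rV[F]_n) : nat :=
  #|[set i | x 0 i != 0]|.

(* Conjugation is the Frobenius x ^+ 2, so this is the Hermitian form only
   when #|F| = 4. *)
Definition hdot (F : finFieldType) (n : nat) (x y : 'rV[F]_n) : F :=
  \sum_i x 0 i * y 0 i ^+ 2.

Definition hdual (F : finFieldType) (n : nat) (C : {vspace 'rV[F]_n}) :
    {set 'rV[F]_n} :=
  [set x | [forall y in C, hdot x y == 0]].

Definition hermitian_LCD (F : finFieldType) (n : nat)
    (C : {vspace 'rV[F]_n}) : Prop :=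
  [set x in C] :&: hdual C = [set 0].

Definition min_weight (F : finFieldType) (n : nat) (C : {vspace 'rV[F]_n})
    (d : nat) : Prop :=
  (exists x, [/\ x \in C, x != 0 & wt x = d]) /\
  (forall x, x \in C -> x != 0 -> (d <= wt x)%N).

Definition is_code (F : finFieldType) (n k d : nat)
    (C : {vspace 'rV[F]_n}) : Prop :=
  (\dim C = k)%N /\ min_weight C d.

Definition ceil_divn (m d : nat) : nat := ((m + d.-1) %/ d)%N.

Definition griesmer (n k d : nat) : bool :=
  (\sum_(i < k) ceil_divn d (4 ^ i) <= n)%N.

(* For k > 0 the term i = 0 forces d <= n, so the bounded maximum is the
   maximum over all d (alpha4P). *)
Definition alpha4 (n k : nat) : nat :=
  (\max_(d < n.+1 | griesmer n k d) d)%N.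

Lemma alpha4P (n k : nat) : (0 < k)%N ->
  griesmer n k (alpha4 n k) /\
  (forall d, griesmer n k d -> (d <= alpha4 n k)%N).
Proof.
case: k => // k _; split.
- have g0 : griesmer n k.+1 (@ord0 n).
    rewrite /griesmer big1 // => i _; rewrite /ceil_divn add0n divn_small //.
    by rewrite ltn_predL expn_gt0.
  rewrite /alpha4.
  have [|j gj ->] := @eq_bigmax_cond _ [pred d : 'I_n.+1 | griesmer n k.+1 d]
    (@nat_of_ord n.+1); last exact: gj.
  by apply/card_gt0P; exists ord0.
- move=> d gd.
  have le_dn : (d < n.+1)%N.
    move: gd; rewrite /griesmer big_ord_recl /= /ceil_divn expn0 addn0 divn1.
    by rewrite ltnS; apply: leq_trans; apply: leq_addr.
  exact: (@leq_bigmax_cond _ (fun e : 'I_n.+1 => griesmer n k.+1 e)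
    (@nat_of_ord n.+1) (Ordinal le_dn)).
Qed.

(* Main.v *)
Require Import Defs.
From mathcomp Require Import all_boot all_order all_algebra all_field.
From mathcomp Require Import zify ring.

(** Averaging the weight over all codewords shows that a code of length
    [s (q^k - 1) / (q - 1)], dimension [k] and minimum weight at least
    [q^(k-1) s] has constant weight [q^(k-1) s].  For [q = 4] and [k >= 2] this
    weight is even, so [<x, x> = wt x = 0] for every codeword; by polarization
    the code is contained in its Hermitian dual, hence it is not LCD. *)

Set Implicit Arguments. Unset Strict Implicit. Unset Printing Implicit Defensive.
Import GRing.Theory.

Section ConstantWeight.
Local Open Scope ring_scope.
Variables (F : finFieldType) (n : nat).
Implicit Types (C : {vspace 'rV[F]_n}) (x y : 'rV[F]_n).

(** If some codeword [y] has value [a] at [i], translation by [- y] injects the fibre over [a] into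
    the fibre over 0. *)
Lemma card_coord_le C (i : 'I_n) (a : F) :
  (#|[set x in C | x 0%R i == a]| <= #|[set x in C | x 0%R i == 0%R]|)%N.
Proof.
have [->|[y]] := set_0Vmem [set x in C | x 0%R i == a]; first by rewrite cards0.
rewrite inE => /andP[yC /eqP ya].
rewrite -(card_imset _ (@addIr _ (- y))); apply/subset_leq_card/subsetP => z.
case/imsetP => x; rewrite !inE => /andP[xC /eqP xa] ->.
by rewrite rpredB //= !mxE xa ya subrr.
Qed.

(** Each of the [#|F|.-1] nonzero fibres is at most as large as the zero fibre. Equality fails when
    coordinate [i] vanishes on all of [C]. *)
Lemma card_coord_neq0_le C (i : 'I_n) :
  (#|F| * #|[set x in C | x 0%R i != 0%R]| <= #|F|.-1 * #|C|)%N.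
Proof.
have splitC : (#|C| = #|[set x in C | x 0%R i == 0%R]|
                      + #|[set x in C | x 0%R i != 0%R]|)%N.
  rewrite -[LHS]sum1_card (bigID (fun x : 'rV[F]_n => x 0 i == 0)) /=.
  by congr (_ + _)%N; rewrite -sum1_card; apply: eq_bigl => x; rewrite inE.
have nz_le : (#|[set x in C | x 0%R i != 0%R]|
              <= #|F|.-1 * #|[set x in C | x 0%R i == 0%R]|)%N.
  have -> : #|[set x in C | x 0%R i != 0%R]| =
            (\sum_(a : F | a != 0%R) #|[set x in C | x 0%R i == a]|)%N.
    rewrite -sum1_card (partition_big (fun x : 'rV[F]_n => x 0 i)
                          (fun a => a != 0)) /=; last first.
      by move=> x; rewrite inE => /andP[].
    apply: eq_bigr => a a0; rewrite -sum1_card; apply: eq_bigl => x.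
    rewrite !inE -andbA; congr (_ && _).
    by have [->|] := eqVneq (x 0 i) a; rewrite ?a0 ?andbF.
  have -> : (#|F|.-1 = #|[pred a : F | a != 0%R]|)%N.
    by rewrite -(cardC1 (0 : F)); apply: eq_card => a; rewrite !inE.
  rewrite -sum_nat_const; apply: leq_sum => a _; exact: card_coord_le.
have F0 : (0 < #|F|)%N by apply/card_gt0P; exists 0.
(* With [z] zero and [w] nonzero values, adding [(q - 1) w] to [w <= (q - 1) z] gives the claim. *)
rewrite splitC; move: nz_le; rewrite -{2}(prednK F0) mulSn mulnDr; lia.
Qed.

(** Double counting of the pairs of a codeword and a coordinate where it is nonzero. *)
Lemma sum_wt_le C : (#|F| * \sum_(x in C) wt x <= n * (#|F|.-1 * #|C|))%N.
Proof.
have -> : (\sum_(x in C) wt x = \sum_(i < n) #|[set x in C | x 0%R i != 0%R]|)%N.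
  under eq_bigr => x _ do rewrite /wt -sum1dep_card big_mkcond.
  rewrite exchange_big /=; apply: eq_bigr => i _.
  rewrite -big_mkcondr -sum1_card; apply: eq_bigl => x; by rewrite inE.
rewrite big_distrr /=.
rewrite -[X in (_ <= X * _)%N]card_ord -sum_nat_const.
by apply: leq_sum => i _; exact: card_coord_neq0_le.
Qed.

Lemma wt0 : wt (0 : 'rV[F]_n) = 0%N.
Proof. by apply/eqP; rewrite cards_eq0; apply/eqP/setP => i; rewrite !inE mxE eqxx. Qed.

(** The first hypothesis says that the bound of [sum_wt_le] is attained when every nonzero codeword
    has weight [d]; a single heavier codeword would exceed it. *)
Lemma constant_weight C d :
  (n * (#|F|.-1 * #|C|) = #|F| * (#|C|.-1 * d))%N ->
  (forall x, x \in C -> x != 0 -> (d <= wt x)%N) ->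
  forall x, x \in C -> x != 0 -> wt x = d.
Proof.
move=> eq_n ge_d x xC x0.
have F0 : (0 < #|F|)%N by apply/card_gt0P; exists 0.
have sum_le : (\sum_(y in C | y != 0%R) wt y <= #|C|.-1 * d)%N.
  rewrite -(leq_pmul2l F0) -eq_n; apply: leq_trans (sum_wt_le C).
  by rewrite leq_mul2l [X in (_ <= X)%N](bigD1 0) ?mem0v //= leq_addl orbT.
have sum_d : (\sum_(y in C | y != 0%R) d = #|C|.-1 * d)%N.
  rewrite (cardD1 (0 : 'rV[F]_n) C) mem0v /= -sum_nat_const.
  by apply: eq_bigl => y; rewrite !inE andbC.
have xP : (x \in C) && (x != 0) by rewrite xC.
move: sum_le; rewrite -sum_d !(bigD1 x xP) /=.
set S := (\sum_(_ | _) wt _)%N; set D := (\sum_(_ | _) d)%N.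
have leD : (D <= S)%N by apply: leq_sum => y /andP[/andP[yC y0] _]; exact: ge_d.
have := ge_d x xC x0; lia.
Qed.

End ConstantWeight.

Section QuaternaryHermitian.
Local Open Scope ring_scope.
Variables (F : finFieldType) (n : nat).
Hypothesis hF : #|F| = 4%N.
Implicit Types (C : {vspace 'rV[F]_n}) (x y : 'rV[F]_n).

Lemma pchar_F4 : 2 \in [pchar F].
Proof. exact: (@card_finPcharP F 2 2). Qed.

Lemma hdot_self x : hdot x x = (wt x)%:R.
Proof.
rewrite /hdot /wt -sum1dep_card natr_sum [RHS]big_mkcond.
apply: eq_bigr => i _; rewrite -exprS; case: eqP => [->|/eqP x0] /=.
  by rewrite expr0n.
(* A nonzero element has cube 1: cancel one factor in [x ^+ 4 = x]. *)
by apply: (mulfI x0); rewrite mulr1 -exprS -hF expf_card.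
Qed.

Lemma hdotDl x x' y : hdot (x + x') y = hdot x y + hdot x' y.
Proof. by rewrite /hdot -big_split; apply: eq_bigr => i _; rewrite !mxE mulrDl. Qed.

Lemma hdotDr x y y' : hdot x (y + y') = hdot x y + hdot x y'.
Proof.
rewrite /hdot -big_split; apply: eq_bigr => i _; rewrite !mxE /= -mulrDr.
(* Squaring is the Frobenius map, hence additive. *)
by rewrite -!(pFrobenius_autE pchar_F4) pFrobenius_autD_comm //; apply: mulrC.
Qed.

Lemma hdotZl a x y : hdot (a *: x) y = a * hdot x y.
Proof. by rewrite /hdot mulr_sumr; apply: eq_bigr => i _; rewrite !mxE mulrA. Qed.

Lemma hdotZr a x y : hdot x (a *: y) = a ^+ 2 * hdot x y.
Proof. by rewrite /hdot mulr_sumr; apply: eq_bigr => i _; rewrite !mxE; ring. Qed.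

Lemma even_weight_self_orthogonal C :
  (forall x, x \in C -> ~~ odd (wt x)) ->
  forall x y, x \in C -> y \in C -> hdot x y = 0.
Proof.
move=> evC.
have self0 x : x \in C -> hdot x x = 0.
  move=> /evC ev; rewrite hdot_self; apply/eqP.
  by rewrite -(dvdn_pcharf pchar_F4) dvdn2.
have anti x y : x \in C -> y \in C -> hdot y x = - hdot x y.
  move=> xC yC; have := self0 _ (rpredD xC yC).
  rewrite hdotDl !hdotDr !self0 // add0r addr0 addrC => /eqP.
  by rewrite addr_eq0 => /eqP.
move=> x y xC yC.
(* A scalar outside the prime field: replacing [x] by [w *: x] in [anti] scales one side by [w ^+ 2]
   and the other by [w], so [(w ^+ 2 - w) * hdot x y = 0]. *)
have [w w0 w1] : exists2 w : F, w != 0 & w != 1.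
  have : [set: F] != [set 0; 1].
    by apply/eqP => /(congr1 (fun A : {set F} => #|A|)); rewrite cardsT hF cards2; case: eqP.
  move/eqP => neq; have [w] : exists w : F, w \notin [set 0; 1].
    apply/existsP; rewrite -negb_forall; apply/negP => /forallP h.
    by apply: neq; apply/setP => z; rewrite h inE.
  by rewrite !inE negb_or => /andP[]; exists w.
have := anti _ _ (rpredZ w xC) yC.
rewrite hdotZl hdotZr (anti x y) // mulrN => /oppr_inj /eqP.
rewrite -subr_eq0 -mulrBl mulf_eq0 => /orP[|/eqP //].
rewrite expr2 -{3}[w]mulr1 -mulrBr mulf_eq0 subr_eq0.
by rewrite (negPf w0) (negPf w1).
Qed.

Lemma self_orthogonal_not_LCD C : (0 < \dim C)%N ->
  (forall x y, x \in C -> y \in C -> hdot x y = 0) -> ~ hermitian_LCD C.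
Proof.
move=> dimC orth lcd.
have : vpick C \in [set x in C] :&: hdual C.
  rewrite !inE memv_pick /=; apply/forall_inP => y yC.
  by rewrite orth ?memv_pick.
by rewrite lcd inE vpick0 -dimv_eq0 -leqn0 leqNgt dimC.
Qed.

End QuaternaryHermitian.

Lemma simplex_length k : (4 ^ k - 1) %/ 3 = \sum_(i < k) 4 ^ i.
Proof. by rewrite subn1 predn_exp mulKn. Qed.

(** Assuming only a lower bound on the weights lets this serve both halves of the theorem. *)
Lemma not_LCD_of_large_weight (F : finFieldType) (k n s : nat)
    (C : {vspace 'rV[F]_n}) :
  #|F| = 4 -> 1 < k -> n = (4 ^ k - 1) %/ 3 * s -> \dim C = k ->
  (forall x, x \in C -> x != 0%R -> 4 ^ (k - 1) * s <= wt x) ->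
  ~ hermitian_LCD C.
Proof.
move=> hF k1 nE dimC ge_d.
have cardC : #|C| = 4 ^ k by rewrite card_vspace hF dimC.
(* Both sides equal [4 ^ k * (4 ^ k - 1) * s]. *)
have lenE : n * (#|F|.-1 * #|C|) = #|F| * (#|C|.-1 * (4 ^ (k - 1) * s)).
  rewrite hF cardC nE simplex_length predn_exp.
  have -> : 4 ^ k = 4 * 4 ^ (k - 1) by rewrite -expnS; congr expn; lia.
  by rewrite /=; ring.
have cw := constant_weight lenE ge_d.
apply: self_orthogonal_not_LCD; first by rewrite dimC; lia.
apply: even_weight_self_orthogonal => // x xC.
have [->|x0] := eqVneq x 0%R; first by rewrite wt0.
(* The weight [4 ^ (k - 1) * s] is even because [k - 1] is positive. *)
by rewrite cw // oddM oddX /= orbF subn_eq0 leqNgt k1.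
Qed.

Lemma griesmer_simplex k s :
  griesmer ((4 ^ k - 1) %/ 3 * s) k (4 ^ (k - 1) * s).
Proof.
(* Reversing the order pairs [4 ^ i * s] with the division by [4 ^ (k - i.+1)], which is exact, so
   the ceiling adds nothing. *)
rewrite /griesmer simplex_length big_distrl /= (reindex_inj rev_ord_inj) /=.
apply: leq_sum => i _; have := ltn_ord i => ltik.
have -> : 4 ^ (k - 1) * s = (4 ^ i * s) * 4 ^ (k - i.+1).
  by rewrite mulnAC -expnD; congr (4 ^ _ * s); lia.
rewrite /ceil_divn divnMDl ?expn_gt0 //.
by rewrite divn_small ?addn0 // ltn_predL expn_gt0.
Qed.

Theorem theorem3p3 (F : finFieldType) (hF : #|F| = 4) (k n : nat)
    (hk : 3 <= k) (hn : 0 < n) (hmod : n = 0 %[mod (4 ^ k - 1) %/ 3]) :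
  (~ exists C : {vspace 'rV[F]_n},
       is_code k (alpha4 n k) C /\ hermitian_LCD C) /\
  (forall s : nat, n = (4 ^ k - 1) %/ 3 * s ->
     ~ exists C : {vspace 'rV[F]_n},
         is_code k (4 ^ (k - 1) * s) C /\ hermitian_LCD C).
Proof.
have k1 : 1 < k by apply: ltnW.
have /dvdnP[t nE] : (4 ^ k - 1) %/ 3 %| n by rewrite /dvdn hmod mod0n.
rewrite mulnC in nE.
split=> [[C [[dimC [_ ge_d]] lcd]]|s sE [C [[dimC [_ ge_d]] lcd]]].
  apply: (not_LCD_of_large_weight hF k1 nE dimC) lcd => x xC x0.
  apply: leq_trans (ge_d x xC x0).
  (* Since [4 ^ (k - 1) * t] satisfies the Griesmer inequality, maximality puts it below
     [alpha4 n k]. *)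
  have [_] := alpha4P n (ltnW k1); apply.
  by rewrite {1}nE; exact: griesmer_simplex.
exact: (not_LCD_of_large_weight hF k1 sE dimC ge_d) lcd.
Qed.
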